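(* Let $(\Gamma_1',\Gamma_2',\tau')$ and $(\Gamma_1,\Gamma_2,\tau)$ be Belavin-Drinfeld triples of type $A_{n-1}$ with $(\Gamma_1',\Gamma_2',\tau')<(\Gamma_1,\Gamma_2,\tau)$, i.e. $\Gamma_1'\subset\Gamma_1$ and $\tau'=\tau|_{\Gamma_1'}$. If the GGS conjecture holds for $(\Gamma_1,\Gamma_2,\tau)$, then it holds for $(\Gamma_1',\Gamma_2',\tau')$; and if the twist conjecture holds for $(\Gamma_1,\Gamma_2,\tau)$, then it holds for $(\Gamma_1',\Gamma_2',\tau')$.
   Context: Roots and triples. Fix $n\ge2$. Let $(e_i)_{1\le i\le n}$ be the standard basis of $\mathbb C^n$, $(\,,\,)$ the bilinear inner product for which it is orthonormal, $\alpha_i=e_i-e_{i+1}$, $\Gamma=\{\alpha_1,\dots,\alpha_{n-1}\}$. A Belavin-Drinfeld triple of type $A_{n-1}$ is $(\Gamma_1,\Gamma_2,\tau)$ with $\Gamma_1,\Gamma_2\subset\Gamma$ and $\tau:\Gamma_1\to\Gamma_2$ a bijection such that $(\tau\alpha,\tau\beta)=(\alpha,\beta)$ for all $\alpha,\beta\in\Gamma_1$, and for every $\alpha\in\Gamma_1$ there is $k\in\mathbb N$ with $\tau^k\alpha\notin\Gamma_1$. Let $e_{ij}$ be the matrix units. For $\alpha=e_i-e_j$ ($i\ne j$) put $e_\alpha=e_{ij}$, $|\alpha|=|j-i|$, and $\alpha>0$ iff $i<j$. For $Y\subset\Gamma$ let $\tilde Y$ be the set of $v\in\mathrm{Span}(Y)$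 of the form $v=e_i-e_j$ with $i<j$. Extend $\tau$ additively to $\tilde\Gamma_1\to\tilde\Gamma_2$. Write $\alpha\prec\beta$ if $\beta=\tau^p\alpha$ for some $p\ge1$. If $\alpha\prec\beta=\tau^p\alpha$ with $\alpha=e_j-e_i$, $\beta=e_k-e_{k+i-j}$, $i-j\ge2$, write $\alpha\prec^{\leftarrow}\beta$ if $\tau^p\alpha_j=\alpha_{k+i-j-1}$, and $\alpha\prec^{\rightarrow}\beta$ if $\tau^p\alpha_j=\alpha_k$. Put $\mathrm{sign}(\alpha,\beta)=(-1)^{1-|\alpha|}$ if $\alpha\prec^{\leftarrow}\beta$, and $\mathrm{sign}(\alpha,\beta)=1$ if $\alpha\prec^{\rightarrow}\beta$ or $|\alpha|=1$. For positive roots, $e_i-e_j\lessdot e_k-e_l$ means $j=k$, and $\alpha\gtrdot\beta$ means $\beta\lessdot\alpha$. $[\text{statement}]$ is $1$ if the statement is true, $0$ otherwise. The matrix $R_{\mathrm{GGS}}$. Let $\mathfrak h$ be the diagonal matrices, with $e_i(e_{jj})=\delta_{ij}$. Let $P=\sum_{i,j}e_{ij}\otimes e_{ji}$, $P^0=\sum_ie_{ii}\otimes e_{ii}$, $x\wedge y=x\otimes y-y\otimes x$. Consider for $r^0\in\mathfrak h\wedge\mathfrak h$ the equation $$[(\alpha-\tau\alpha)\otimes1]\,r^0=\tfrac12[(\alpha+\tau\alpha)\otimes1]\,P^0\quad\text{for all }\alpha\in\Gamma_1.\qquad( * )$$ Set $q=e^\hbar$ ($\hbar$ formal; $q^x=\exp(\hbar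 x)$), and $$a=\sum_{\alpha\prec\beta}\mathrm{sign}(\alpha,\beta)\,e_{-\alpha}\wedge e_\beta,\quad r_s=\tfrac12P^0+\sum_{\alpha>0}e_{-\alpha}\otimes e_\alpha,\quad \epsilon=ar_s+r_sa+a^2,$$ $$R_s=q\sum_i e_{ii}\otimes e_{ii}+\sum_{i\ne j}e_{ii}\otimes e_{jj}+(q-q^{-1})\sum_{i>j}e_{ij}\otimes e_{ji}.$$ Writing $z=\sum z_{ik}^{jl}e_{ij}\otimes e_{kl}$, set $\tilde a=\sum a_{ik}^{jl}q^{a_{ik}^{jl}\epsilon_{ik}^{jl}}e_{ij}\otimes e_{kl}$, $\bar R_{\mathrm{GGS}}=R_s+(q-q^{-1})\tilde a$ and $R_{\mathrm{GGS}}=q^{r^0}\bar R_{\mathrm{GGS}}q^{r^0}$. The matrix $R_J$. For $\alpha\prec\beta$ let $$K_{\alpha,\beta}=\tfrac12[\alpha\lessdot\beta]-\tfrac12[\alpha\gtrdot\beta]+[\exists\gamma:\alpha\prec\gamma\prec\beta,\alpha\lessdot\gamma]-[\exists\gamma:\alpha\prec\gamma\prec\beta,\alpha\gtrdot\gamma]+[\alpha\prec^{\leftarrow}\beta](1-|\alpha|),$$ and for $p\ge1$ $$A^p=(q-q^{-1})\sum_{\beta=\tau^p(\alpha)}\mathrm{sign}(\alpha,\beta)q^{K_{\alpha,\beta}}e_\beta\otimes e_{-\alpha},\quad J^p=1+A^p,\quad J=J^1J^2\cdots J^d,$$ where $d$ is the largest $p$ for which $\tau^p$ is defined on some element of $\tilde\Gamma_1$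 (if $\Gamma_1=\emptyset$, $J=1$). Set $\bar R_J=J^{-1}R_sJ_{21}$ and $R_J=q^{r^0}\bar R_Jq^{r^0}$, where the subscript $21$ denotes exchanging tensor factors. The conjectures. The quantum Yang-Baxter equation (QYBE) is $R_{12}R_{13}R_{23}=R_{23}R_{13}R_{12}$; the Hecke relation is $(PR-q)(PR+q^{-1})=0$. The GGS conjecture holds for a triple if, for every $r^0\in\mathfrak h\wedge\mathfrak h$ solving ( * ) for that triple, $R_{\mathrm{GGS}}$ satisfies the QYBE and the Hecke relation. The twist conjecture holds for a triple if, for every such $r^0$, $R_J$ satisfies the QYBE and $R_J=R_{\mathrm{GGS}}$. *)

(* Defs.v *)
From HB Require Import structures.
From mathcomp Require Import all_boot all_order all_algebra.
From mathcomp Require Import boolp classical_sets reals.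
From mathcomp Require Import complex mxtens.

Set Implicit Arguments.
Unset Strict Implicit.
Unset Printing Implicit Defensive.

Import GRing.Theory.
Local Open Scope ring_scope.

Arguments mxtens_index {m n}.

(* Formal power series in one variable (written hbar below) over K. *)
Record fps (K : Type) := FPS { fps_coef :> nat -> K }.

Section FpsRing.
Variable K : comNzRingType.
Implicit Types f g h : fps K.

HB.instance Definition _ := gen_eqMixin (fps K).
HB.instance Definition _ := gen_choiceMixin (fps K).

Lemma fpsP f g : (forall m, f m = g m) -> f = g.
Proof. by case: f g => [f] [g] /= /funext ->. Qed.

Definition fps_zero : fps K := FPS (fun=> 0).
Definition fps_opp f : fps K := FPS (fun m => - f m).
Definition fps_add f g : fps K := FPS (fun m => f m + g m).

Lemma fps_addA : associative fps_add.
Proof. by move=> f g h; apply/fpsP => m /=; rewrite addrA. Qed.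
Lemma fps_addC : commutative fps_add.
Proof. by move=> f g; apply/fpsP => m /=; rewrite addrC. Qed.
Lemma fps_add0 : left_id fps_zero fps_add.
Proof. by move=> f; apply/fpsP => m /=; rewrite add0r. Qed.
Lemma fps_addN : left_inverse fps_zero fps_opp fps_add.
Proof. by move=> f; apply/fpsP => m /=; rewrite addNr. Qed.

HB.instance Definition _ :=
  GRing.isZmodule.Build (fps K) fps_addA fps_addC fps_add0 fps_addN.

Definition fps_const (c : K) : fps K := FPS (fun m => if m == 0 then c else 0).
Definition fps_mul f g : fps K :=
  FPS (fun m => \sum_(j < m.+1) f j * g (m - j)%N).

Lemma fps_mulC : commutative fps_mul.
Proof.
move=> f g; apply/fpsP => m /=; rewrite (reindex_inj rev_ord_inj) /=.
by apply: eq_bigr => j _; rewrite subSS subKn ?leq_ord// mulrC.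
Qed.

Lemma fps_mulA : associative fps_mul.
Proof.
move=> p q r; rewrite [fps_mul q r]fps_mulC; apply/fpsP => i /=.
rewrite [RHS](reindex_inj rev_ord_inj) /=.
pose coef3 j k := p j * (q (i - j - k)%N * r k).
transitivity (\sum_(j < i.+1) \sum_(k < i.+1 | (k <= i - j)%N) coef3 j k).
  apply: eq_bigr => /= j _; rewrite big_distrr /=.
  rewrite (big_ord_narrow_leq (leq_subr _ _)) /=.
  by apply: eq_bigr => k _; rewrite /coef3 [r _ * _]mulrC.
rewrite (exchange_big_dep predT) //=; apply: eq_bigr => k _.
transitivity (\sum_(j < i.+1 | (j <= i - k)%N) coef3 j k).
  apply: eq_bigl => j; rewrite -ltnS -(ltnS j) -!subSn ?leq_ord //.
  by rewrite -subn_gt0 -(subn_gt0 j) -!subnDA addnC.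
rewrite (big_ord_narrow_leq (leq_subr _ _)) subSS subKn ?leq_ord// big_distrl /=.
by apply: eq_bigr => j _; rewrite /coef3 -!subnDA addnC mulrA.
Qed.

Lemma fps_mul1 : left_id (fps_const 1) fps_mul.
Proof.
move=> f; apply/fpsP => m /=; rewrite big_ord_recl /= mul1r subn0.
by rewrite big1 ?addr0// => j _; rewrite mul0r.
Qed.

Lemma fps_mulDl : left_distributive fps_mul fps_add.
Proof.
move=> f g h; apply/fpsP => m /=; rewrite -big_split /=.
by apply: eq_bigr => j _; rewrite mulrDl.
Qed.

Lemma fps_oner_neq0 : fps_const 1 != 0.
Proof.
apply/eqP => /(congr1 (fun f : fps K => f 0%N)) /= /eqP.
by rewrite oner_eq0.
Qed.

HB.instance Definition _ := GRing.Zmodule_isComNzRing.Build (fps K)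
  fps_mulA fps_mulC fps_mul1 fps_mulDl fps_oner_neq0.

Definition fps_unit : {pred fps K} := fun f => `[< exists g, g * f = 1 >].
Definition fps_inv f : fps K := xget f [set g | g * f = 1].

Lemma fps_mulVf : {in fps_unit, left_inverse 1 fps_inv *%R}.
Proof. by move=> f /asboolP ex; exact: (xgetPex f ex). Qed.
Lemma fps_unitP f g : g * f = 1 -> fps_unit f.
Proof. by move=> gf; apply/asboolP; exists g. Qed.
Lemma fps_invr_out : {in [predC fps_unit], fps_inv =1 id}.
Proof.
move=> f /asboolPn nf; apply: xgetPN => g gf.
by apply: nf; exists g.
Qed.

HB.instance Definition _ := GRing.ComNzRing_hasMulInverse.Build (fps K)
  fps_mulVf fps_unitP fps_invr_out.

End FpsRing.

(* Mat_n (x) Mat_n is 'M_(n * n), with *t (Kronecker product) as (x). *)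
Section Tensors.
Variables (K : comNzRingType) (n : nat).
Implicit Types z : 'M[K]_(n * n).

Definition emx (i j : 'I_n) : 'M[K]_n := delta_mx i j.

(* z_{ik}^{jl}, the coefficient of e_ij (x) e_kl in z *)
Definition tcoef z (i j k l : 'I_n) : K :=
  z (mxtens_index (i, k)) (mxtens_index (j, l)).

(* the linear map sending e_ij (x) e_kl to F i j k l *)
Definition tlin (V : lmodType K) (F : 'I_n -> 'I_n -> 'I_n -> 'I_n -> V) z : V :=
  \sum_i \sum_j \sum_k \sum_l tcoef z i j k l *: F i j k l.

Definition wedge (x y : 'M[K]_n) : 'M[K]_(n * n) := x *t y - y *t x.

Definition swap z : 'M[K]_(n * n) := tlin (fun i j k l => emx k l *t emx i j) z.

Definition leg12 z : 'M[K]_(n * n * n) :=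
  tlin (fun i j k l => emx i j *t emx k l *t (1%:M : 'M[K]_n)) z.
Definition leg13 z : 'M[K]_(n * n * n) :=
  tlin (fun i j k l => emx i j *t (1%:M : 'M[K]_n) *t emx k l) z.
Definition leg23 z : 'M[K]_(n * n * n) :=
  tlin (fun i j k l => (1%:M : 'M[K]_n) *t emx i j *t emx k l) z.

Definition Pmx : 'M[K]_(n * n) := \sum_i \sum_j emx i j *t emx j i.
Definition P0mx : 'M[K]_(n * n) := \sum_i emx i i *t emx i i.

Definition QYBE z : Prop :=
  leg12 z *m leg13 z *m leg23 z = leg23 z *m leg13 z *m leg12 z.

Definition Hecke (q qV : K) z : Prop :=
  (Pmx *m z - q%:M) *m (Pmx *m z + qV%:M) = 0.

End Tensors.

Arguments emx {K n} i j.
Arguments Pmx {K n}.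
Arguments P0mx {K n}.

Section BelavinDrinfeld.
Variables (R : realType) (n : nat).
Local Notation C := R[i].
Local Notation A := (fps R[i]).

(* The pair (i, j) stands for e_i - e_j. *)
Local Notation root := ('I_n * 'I_n)%type.
Implicit Types (r s t : root) (Y : {set root}).

Definition vec r : 'rV[C]_n := delta_mx 0 r.1 - delta_mx 0 r.2.
Definition dot (u v : 'rV[C]_n) : C := \sum_i u 0 i * v 0 i.
Definition height r : nat := `|r.2%:Z - r.1%:Z|%N.
Definition positive r : bool := (r.1 < r.2)%N.
Definition simple_roots : {set root} := [set r : root | r.2 == r.1.+1 :> nat].

(* The values of [tau] outside [G1] are irrelevant. *)
Record bd_triple := BDTriple {
  G1 : {set root};
  G2 : {set root};
  tau : root -> root;
  _ : G1 \subset simple_roots;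
  _ : G2 \subset simple_roots;
  _ : {in G1 &, injective tau};
  _ : [set tau r | r in G1] = G2;
  _ : {in G1 &, forall r s, dot (vec (tau r)) (vec (tau s)) = dot (vec r) (vec s)};
  _ : {in G1, forall r, exists k, iter k tau r \notin G1}
}.

Definition bd_sub (T' T : bd_triple) : Prop :=
  (G1 T' \subset G1 T) /\ {in G1 T', tau T' =1 tau T}.

(* \tilde Y *)
Definition pos_span Y : {set root} :=
  [set r : root | positive r & vec r \in <<[seq vec s | s in Y]>>%VS].

Definition Eroot (S : comNzRingType) r : 'M[S]_n := emx r.1 r.2.
Definition Eneg (S : comNzRingType) r : 'M[S]_n := emx r.2 r.1.

Definition precdot r s : bool := r.2 == s.1.

Definition qpow (x : C) : A := FPS (fun m => x ^+ m / m`!%:R).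
Definition qexp (m : nat) (X : 'M[C]_m) : 'M[A]_m :=
  \matrix_(i, j) FPS (fun k => (X ^+ k) i j / k`!%:R).
Local Notation q := (qpow 1).
Local Notation qV := (qpow (-1)).

Definition rs : 'M[C]_(n * n) :=
  2^-1 *: P0mx + \sum_(r : root | positive r) Eneg C r *t Eroot C r.

Definition Rs : 'M[A]_(n * n) :=
  q *: (\sum_i emx i i *t emx i i) + \sum_i \sum_(j | i != j) emx i i *t emx j j
  + (q - qV) *: (\sum_(i < n) \sum_(j < n | (j < i)%N) emx i j *t emx j i).

Definition in_h_wedge_h (z : 'M[C]_(n * n)) : Prop :=
  exists s : seq ('M[C]_n * 'M[C]_n),
    all (fun xy => is_diag_mx xy.1 && is_diag_mx xy.2) s
    /\ z = \sum_(xy <- s) wedge xy.1 xy.2.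

(* v as a linear form on diagonal matrices, with e_i(e_jj) = delta_ij *)
Definition form (v : 'rV[C]_n) (D : 'M[C]_n) : C := \sum_i v 0 i * D i i.

(* (v (x) 1) z, for z in h (x) h *)
Definition contract (v : 'rV[C]_n) (z : 'M[C]_(n * n)) : 'M[C]_n :=
  tlin (fun i j k l => form v (emx i j) *: emx k l) z.

Section Triple.
Variable T : bd_triple.

(* [tau_ext r s]: r is in \tilde\Gamma_1 and s is its image under the additive
   extension of tau. *)
Definition tau_ext r s : Prop :=
  [/\ r \in pos_span (G1 T), s \in pos_span (G2 T) &
      exists c : root -> nat,
        vec r = \sum_(t in G1 T) vec t *+ c t
        /\ vec s = \sum_(t in G1 T) vec (tau T t) *+ c t].

(* [tau_pow p r s]: tau^p r is defined and equal to s. *)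
Fixpoint tau_pow (p : nat) r s : Prop :=
  if p is p'.+1 then exists2 t, tau_ext r t & tau_pow p' t s else r = s.

Definition prec r s : Prop := exists2 p, (1 <= p)%N & tau_pow p r s.

Definition prec_left r s : Prop :=
  (2 <= height r)%N /\
  exists2 p, (1 <= p)%N & tau_pow p r s /\
    exists a b, [/\ a \in simple_roots, b \in simple_roots,
                    a.1 = r.1, b.2 = s.2 & tau_pow p a b].

Definition prec_right r s : Prop :=
  (2 <= height r)%N /\
  exists2 p, (1 <= p)%N & tau_pow p r s /\
    exists a b, [/\ a \in simple_roots, b \in simple_roots,
                    a.1 = r.1, b.1 = s.1 & tau_pow p a b].

(* The final 0 is a junk value, for pairs with sign(r, s) undefined. *)
Definition sign r s : C :=
  if `[< prec_left r s >] then (-1) ^ (1 - (height r)%:Z)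
  else if `[< prec_right r s >] || (height r == 1%N) then 1 else 0.

Definition amx : 'M[C]_(n * n) :=
  \sum_(r : root) \sum_(s : root | `[< prec r s >])
    sign r s *: wedge (Eneg C r) (Eroot C s).

Definition eps : 'M[C]_(n * n) := amx *m rs + rs *m amx + amx *m amx.

Definition a_tilde : 'M[A]_(n * n) :=
  \matrix_(i, j) (fps_const (amx i j) * qpow (amx i j * eps i j)).

Definition Rbar_GGS : 'M[A]_(n * n) := Rs + (q - qV) *: a_tilde.

Definition R_GGS (r0 : 'M[C]_(n * n)) : 'M[A]_(n * n) :=
  qexp r0 *m Rbar_GGS *m qexp r0.

Definition Kexp r s : C :=
  2^-1 * (precdot r s)%:R - 2^-1 * (precdot s r)%:R
  + `[< exists t, [/\ prec r t, prec t s & precdot r t] >]%:R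
  - `[< exists t, [/\ prec r t, prec t s & precdot t r] >]%:R
  + `[< prec_left r s >]%:R * (1 - (height r)%:R).

Definition Apow (p : nat) : 'M[A]_(n * n) :=
  (q - qV) *: (\sum_(r : root) \sum_(s : root | `[< tau_pow p r s >])
    (fps_const (sign r s) * qpow (Kexp r s)) *: (Eroot A s *t Eneg A r)).

Definition Jpow (p : nat) : 'M[A]_(n * n) := 1%:M + Apow p.

Definition tau_pow_defined (p : nat) : Prop :=
  exists2 r, r \in pos_span (G1 T) & exists s, tau_pow p r s.

(* the largest p such that [tau_pow_defined p], or 0 if G1 is empty *)
Definition depth : nat :=
  xget 0%N [set d | tau_pow_defined d
                    /\ forall p, tau_pow_defined p -> (p <= d)%N].

Definition Jmx : 'M[A]_(n * n) := \big[mulmx/1%:M]_(1 <= p < depth.+1) Jpow p.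

Definition Rbar_J : 'M[A]_(n * n) := invmx Jmx *m Rs *m swap Jmx.

Definition R_J (r0 : 'M[C]_(n * n)) : 'M[A]_(n * n) :=
  qexp r0 *m Rbar_J *m qexp r0.

Definition r0_eq (r0 : 'M[C]_(n * n)) : Prop :=
  {in G1 T, forall r, contract (vec r - vec (tau T r)) r0
                      = 2^-1 *: contract (vec r + vec (tau T r)) P0mx}.

Definition GGS_conjecture : Prop :=
  forall r0 : 'M[C]_(n * n), in_h_wedge_h r0 -> r0_eq r0 ->
    QYBE (R_GGS r0) /\ Hecke q qV (R_GGS r0).

Definition twist_conjecture : Prop :=
  forall r0 : 'M[C]_(n * n), in_h_wedge_h r0 -> r0_eq r0 ->
    QYBE (R_J r0) /\ R_J r0 = R_GGS r0.

End Triple.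
End BelavinDrinfeld.

(* Main.v *)
(* Choose h in the Cartan subalgebra with (alpha - tau alpha)(h) equal to 0 on Gamma_1' and
   to 1 on Gamma_1 \ Gamma_1'; nilpotency of tau makes this possible.  If
   alpha precedes beta for tau, then (alpha - beta)(h) is a nonnegative integer, which
   vanishes exactly when alpha precedes beta for tau'.  So for the grading by h every
   ingredient for tau is triangular and its weight-0 part is the ingredient for tau'.
   Taking weight-0 parts is multiplicative on triangular elements, so the identities pass
   from tau to tau' for an r^0 that solves the equations of tau; such an r^0
   exists.  Another solution r'^0 for tau' differs from it by a z whose contraction with
   alpha - tau' alpha is 0; R then changes by the twist by q^z, which preserves the QYBE
   (R has weight 0 for each component of z) and the Hecke relation. *)

Require Import Defs.
From mathcomp Require Import all_boot all_order all_algebra.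
From mathcomp Require Import boolp reals.
From mathcomp Require Import complex mxtens ring.

Set Implicit Arguments.
Unset Strict Implicit.
Unset Printing Implicit Defensive.

Import Order.TTheory GRing.Theory Num.Theory.
Local Open Scope ring_scope.

(** * Weight-0 parts of triangular matrices *)

Section LeadingPart.
Variables (C : numDomainType) (A : pzRingType) (N : nat) (w : 'I_N -> C).
Implicit Types X Y : 'M[A]_N.

(* X has no entries of positive weight w i - w j, and Y is its weight-0 part. *)
Definition lead X Y := forall i j,
  (X i j != 0 -> w i <= w j) /\ Y i j = X i j *+ (w i == w j).

(** The device that carries identities from [tau] to its restriction: a matrix computed in two ways
    for [tau] has its weight-0 part computed in two ways, and the results must agree. *)
Lemma lead_inj X Y Y' : lead X Y -> lead X Y' -> Y = Y'.
Proof.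
by move=> XY XY'; apply/matrixP=> i j; rewrite (XY i j).2 (XY' i j).2.
Qed.

Lemma lead_idP X : (forall i j, X i j != 0 -> w i = w j) <-> lead X X.
Proof.
split=> [h i j|h i j nz].
  split=> [/h -> //|]; have [-> | nz] := eqVneq (X i j) 0.
    by rewrite mul0rn.
  by rewrite (h _ _ nz) eqxx.
by apply/eqP; apply: contraNT nz => /negPf ne; rewrite (h i j).2 ne.
Qed.

Lemma lead0 : lead 0 0.
Proof. by apply/lead_idP=> i j; rewrite mxE eqxx. Qed.

Lemma lead_diag X : is_diag_mx X -> lead X X.
Proof.
move=> /is_diag_mxP dX; apply/lead_idP=> i j; apply: contra_neqP => ne.
by apply: dX; apply: contra_not_neq ne => /val_inj ->.
Qed.

Lemma leadD X X' Y Y' : lead X Y -> lead X' Y' -> lead (X + X') (Y + Y').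
Proof.
move=> h h' i j; have [a b] := h i j; have [a' b'] := h' i j.
rewrite !mxE b b' mulrnDl; split=> //.
by have [->|/a //] := eqVneq (X i j) 0; rewrite add0r.
Qed.

Lemma leadN X Y : lead X Y -> lead (- X) (- Y).
Proof. by move=> h i j; have [a b] := h i j; rewrite !mxE oppr_eq0 b mulNrn. Qed.

Lemma leadB X X' Y Y' : lead X Y -> lead X' Y' -> lead (X - X') (Y - Y').
Proof. by move=> h /leadN; apply: leadD. Qed.

Lemma leadZ c X Y : lead X Y -> lead (c *: X) (c *: Y).
Proof.
move=> h i j; have [a b] := h i j; rewrite !mxE b mulrnAr; split=> // nz.
by apply: a; apply: contraNneq nz => ->; rewrite mulr0.
Qed.

Lemma lead_sum (I : Type) (r : seq I) (P : pred I) (F G : I -> 'M[A]_N) :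
  (forall i, P i -> lead (F i) (G i)) ->
  lead (\sum_(i <- r | P i) F i) (\sum_(i <- r | P i) G i).
Proof. by move=> h; elim/big_ind2: _ => // [|X X2 Y Y2]; [exact: lead0 | exact: leadD]. Qed.

(** Serves the sums over pairs related by powers of [tau]; the pairs lost on passing to [tau'] are
    those outside [Q]. *)
Lemma lead_sum_cond (I : Type) (r : seq I) (P Q : pred I) (F G : I -> 'M[A]_N) :
  (forall i, Q i -> P i) -> (forall i, Q i -> lead (F i) (G i)) ->
  (forall i, P i -> ~~ Q i -> lead (F i) 0) ->
  lead (\sum_(i <- r | P i) F i) (\sum_(i <- r | Q i) G i).
Proof.
move=> QP hQ hP; rewrite [X in lead _ X]big_mkcond [X in lead X _]big_mkcond.
apply: lead_sum => i _; case: (boolP (Q i)) => [Qi|nQi].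
  by rewrite QP //; apply: hQ.
by case: ifP => [Pi|_]; [apply: hP | apply: lead0].
Qed.

(** Along a nonzero product term the weights satisfy [w i <= w k <= w j], so antisymmetry of the
    order makes total weight 0 force weight 0 in both factors. *)
Lemma leadM X X' Y Y' : lead X Y -> lead X' Y' -> lead (X *m X') (Y *m Y').
Proof.
move=> h h' i j; rewrite !mxE; split=> [nz|].
  have [k _ nzk] : exists2 k, true & X i k * X' k j != 0.
    apply/exists_inP; apply: contraNT nz; rewrite negb_exists_in => /forall_inP z.
    by rewrite big1 // => k _; apply/eqP; rewrite -[_ == 0]negbK z.
  apply: (le_trans ((h i k).1 _) ((h' k j).1 _)).
    by apply: contraNneq nzk => ->; rewrite mul0r.
  by apply: contraNneq nzk => ->; rewrite mulr0.
rewrite -sumrMnl; apply: eq_bigr => k _.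
rewrite (h i k).2 (h' k j).2 mulrnAl mulrnAr -mulrnA mulnb andbC.
have [-> | n1] := eqVneq (X i k) 0; first by rewrite !mul0r !mul0rn.
have [-> | n2] := eqVneq (X' k j) 0; first by rewrite !mulr0 !mul0rn.
have l1 := (h i k).1 n1; have l2 := (h' k j).1 n2.
congr (_ *+ _); congr nat_of_bool; apply/andP/eqP => [[/eqP -> /eqP //]|e].
have e1 : w i = w k by apply/eqP; rewrite eq_le l1 e.
by rewrite -e e1.
Qed.

Lemma lead_prod (I : eqType) (r : seq I) (F G : I -> 'M[A]_N) :
  {in r, forall i, lead (F i) (G i)} ->
  lead (\big[mulmx/1%:M]_(i <- r) F i) (\big[mulmx/1%:M]_(i <- r) G i).
Proof.
move=> h; rewrite big_seq [X in lead _ X]big_seq.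
elim/big_ind2: _ => [|X X2 Y Y2|//]; last exact: leadM.
by apply: lead_diag; apply: scalar_mx_is_diag.
Qed.

End LeadingPart.

(** Where the weight is nonzero both new arguments are 0, and [phi 0 0 = 0]. This handles [a_tilde],
    whose entries depend nonlinearly on those of [amx] and [eps]. *)
Lemma lead_map2 (C : numDomainType) (A B : pzRingType) N (w : 'I_N -> C)
    (phi : A -> A -> B) (X X' Y Y' : 'M[A]_N) : (forall y, phi 0 y = 0) ->
  lead w X X' -> lead w Y Y' ->
  lead w (\matrix_(i, j) phi (X i j) (Y i j)) (\matrix_(i, j) phi (X' i j) (Y' i j)).
Proof.
move=> phi0 hX hY i j; rewrite !mxE (hX i j).2 (hY i j).2; split=> [nz|].
  by apply: (hX i j).1; apply: contraNneq nz => ->; rewrite phi0.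
by case: eqP => _; rewrite ?mulr1n // !mulr0n phi0.
Qed.

Section TensorWeights.
Variables (C : numDomainType) (m p : nat) (u : 'I_m -> C) (v : 'I_p -> C).

Definition wtens (x : 'I_(m * p)) : C :=
  u (mxtens_unindex x).1 + v (mxtens_unindex x).2.

Lemma wtensE i k : wtens (mxtens_index (i, k)) = u i + v k.
Proof. by rewrite /wtens mxtens_indexK. Qed.

End TensorWeights.

(** * Tensor legs and diagonal twists *)

Section TensorEntries.
Variables (K : comNzRingType) (n : nat).
Implicit Type z : 'M[K]_(n * n).
Local Notation "x # y" := (mxtens_index (x, y)) (at level 30).

Lemma emxE (i j k l : 'I_n) : emx i j k l = ((k == i) && (l == j))%:R :> K.
Proof. by rewrite /emx mxE. Qed.

Lemma sum_delta (I : finType) (F : I -> K) a :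
  \sum_i F i * (a == i)%:R = F a.
Proof.
rewrite (bigD1 a) //= eqxx mulr1 big1 ?addr0 // => i.
by rewrite eq_sym => /negPf ->; rewrite mulr0.
Qed.

(** The four indicators collapse the fourfold sum to one coefficient; [e] accounts for the identity
    in a spare leg. *)
Lemma tlinE (a b c d : 'I_n) (m p : nat) z
    (F : 'I_n -> 'I_n -> 'I_n -> 'I_n -> 'M[K]_(m, p)) x y e :
  (forall i j k l, F i j k l x y
     = (a == i)%:R * (b == j)%:R * (c == k)%:R * (d == l)%:R * e) ->
  tlin F z x y = z (a # c) (b # d) * e.
Proof.
move=> FE; rewrite /tlin summxE -[in RHS](sum_delta (fun i => z (i # c) (b # d))).
rewrite mulr_suml; apply: eq_bigr => i _; rewrite summxE.
rewrite -(sum_delta (fun j => z (i # c) (j # d))) !mulr_suml.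
apply: eq_bigr => j _; rewrite summxE.
rewrite -(sum_delta (fun k => z (i # k) (j # d))) !mulr_suml.
apply: eq_bigr => k _; rewrite summxE.
rewrite -(sum_delta (fun l => z (i # k) (j # l))) !mulr_suml.
apply: eq_bigr => l _; rewrite mxE FE /tcoef.
by move: (a == i)%:R (b == j)%:R (c == k)%:R (d == l)%:R => *; ring.
Qed.

Lemma leg12E z (i k p j l q : 'I_n) :
  leg12 z ((i # k) # p) ((j # l) # q) = z (i # k) (j # l) * (p == q)%:R.
Proof.
apply: tlinE => a b c d; rewrite !tensmxE !emxE mxE -!mulnb !natrM; ring.
Qed.

Lemma leg13E z (i k p j l q : 'I_n) :
  leg13 z ((i # k) # p) ((j # l) # q) = z (i # p) (j # q) * (k == l)%:R.
Proof.
apply: tlinE => a b c d; rewrite !tensmxE !emxE mxE -!mulnb !natrM; ring.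
Qed.

Lemma leg23E z (i k p j l q : 'I_n) :
  leg23 z ((i # k) # p) ((j # l) # q) = z (k # p) (l # q) * (i == j)%:R.
Proof.
apply: tlinE => a b c d; rewrite !tensmxE !emxE mxE -!mulnb !natrM; ring.
Qed.

Lemma swapE z (i k j l : 'I_n) : swap z (i # k) (j # l) = z (k # i) (l # j).
Proof.
rewrite -[RHS]mulr1; apply: tlinE => a b c d.
rewrite !tensmxE !emxE -!mulnb !natrM; ring.
Qed.

Lemma PmxE (i k j l : 'I_n) : Pmx (i # k) (j # l) = (i == l)%:R * (j == k)%:R :> K.
Proof.
rewrite /Pmx summxE -(sum_delta (fun a => (a == l)%:R)) mulr_suml.
apply: eq_bigr => a _; rewrite summxE.
rewrite -[(j == k)%:R](sum_delta (fun b => (j == b)%:R) k) mulr_sumr.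
by apply: eq_bigr => b _; rewrite tensmxE !emxE -!mulnb !natrM (eq_sym a l); ring.
Qed.

(** * Weight-0 parts of legs and swaps, and their effect on the QYBE and the Hecke relation *)

Section LeadTensors.
Variables (C : numDomainType) (h : 'I_n -> C).
Local Notation w2 := (wtens h h).
Local Notation w3 := (wtens w2 h).

(** The identity leg is nonzero only where its row and column indices agree, so it shifts both
    weights equally; the other two legs work alike. *)
Lemma lead_leg12 (X Y : 'M[K]_(n * n)) : lead w2 X Y -> lead w3 (leg12 X) (leg12 Y).
Proof.
move=> XY x y; case: (mxtens_indexP x) => x' p; case: (mxtens_indexP x') => i k.
case: (mxtens_indexP y) => y' q; case: (mxtens_indexP y') => j l.
have [le e] := XY (i # k) (j # l); rewrite !wtensE in le e *.
rewrite !leg12E; have [->|_] := eqVneq p q; last first.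
  by rewrite !mulr0 mul0rn eqxx.
by rewrite !mulr1 e lerD2r (inj_eq (addIr _)).
Qed.

Lemma lead_leg13 (X Y : 'M[K]_(n * n)) : lead w2 X Y -> lead w3 (leg13 X) (leg13 Y).
Proof.
move=> XY x y; case: (mxtens_indexP x) => x' p; case: (mxtens_indexP x') => i k.
case: (mxtens_indexP y) => y' q; case: (mxtens_indexP y') => j l.
have [le e] := XY (i # p) (j # q); rewrite !wtensE in le e *.
rewrite !leg13E; have [->|_] := eqVneq k l; last first.
  by rewrite !mulr0 mul0rn eqxx.
by rewrite !mulr1 e !(addrAC _ (h l)) lerD2r (inj_eq (addIr _)).
Qed.

Lemma lead_leg23 (X Y : 'M[K]_(n * n)) : lead w2 X Y -> lead w3 (leg23 X) (leg23 Y).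
Proof.
move=> XY x y; case: (mxtens_indexP x) => x' p; case: (mxtens_indexP x') => i k.
case: (mxtens_indexP y) => y' q; case: (mxtens_indexP y') => j l.
have [le e] := XY (k # p) (l # q); rewrite !wtensE in le e *.
rewrite !leg23E; have [->|_] := eqVneq i j; last first.
  by rewrite !mulr0 mul0rn eqxx.
by rewrite !mulr1 e -!addrA lerD2l (inj_eq (addrI _)).
Qed.

Lemma lead_swap (X Y : 'M[K]_(n * n)) : lead w2 X Y -> lead w2 (swap X) (swap Y).
Proof.
move=> XY x y; case: (mxtens_indexP x) => i k; case: (mxtens_indexP y) => j l.
have := XY (k # i) (l # j).
by rewrite !swapE !wtensE (addrC (h i)) (addrC (h j)).
Qed.

Lemma lead_Pmx : lead w2 (Pmx : 'M[K]_(n * n)) Pmx.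
Proof.
apply/lead_idP => x y.
case: (mxtens_indexP x) => i k; case: (mxtens_indexP y) => j l.
rewrite PmxE !wtensE -natrM mulnb.
have [->|_] := eqVneq i l; last by rewrite eqxx.
by have [->|_] := eqVneq j k; rewrite ?eqxx // addrC.
Qed.

Lemma lead_tensE (i j k l : 'I_n) x y :
  (emx i j *t emx k l : 'M[K]_(n * n)) x y != 0 -> x = i # k /\ y = j # l.
Proof.
case: (mxtens_indexP x) => a c; case: (mxtens_indexP y) => b d.
rewrite tensmxE !emxE -natrM mulnb.
case: (boolP (_ && _)) => [|_]; last by rewrite eqxx.
by move=> /andP[/andP[/eqP-> /eqP->] /andP[/eqP-> /eqP->]].
Qed.

Lemma lead_tens_lt (i j k l : 'I_n)  : h i + h k < h j + h l ->
  lead w2 (emx i j *t emx k l : 'M[K]_(n * n)) 0.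
Proof.
move=> lt x y; have -> : (0 : 'M[K]_(n * n)) x y = 0 by rewrite mxE.
have [->|/lead_tensE[-> ->]] := eqVneq ((emx i j *t emx k l : 'M[K]_(n * n)) x y) 0.
  by rewrite mul0rn.
by rewrite !wtensE lt_eqF // ltW.
Qed.

Lemma lead_tens_eq (i j k l : 'I_n)  : h i + h k = h j + h l ->
  lead w2 (emx i j *t emx k l : 'M[K]_(n * n)) (emx i j *t emx k l).
Proof. by move=> e; apply/lead_idP => x y /lead_tensE[-> ->]; rewrite !wtensE. Qed.

(** The equation for [X] makes its two sides one triangular matrix, whose weight-0 part is computed
    from either product. *)
Lemma lead_QYBE (X Y : 'M[K]_(n * n)) : lead w2 X Y -> QYBE X -> QYBE Y.
Proof.
move=> XY qX; have [[l12 l13] l23] := (lead_leg12 XY, lead_leg13 XY, lead_leg23 XY).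
apply: (@lead_inj _ _ _ w3 (leg12 X *m leg13 X *m leg23 X)).
  by do !apply: leadM.
by rewrite [X in lead _ X]qX; do !apply: leadM.
Qed.

Lemma lead_Hecke q qV (X Y : 'M[K]_(n * n)) : lead w2 X Y -> Hecke q qV X -> Hecke q qV Y.
Proof.
move=> XY hX.
have PXY := leadM lead_Pmx XY.
have dl c : lead w2 (c%:M : 'M[K]_(n * n)) c%:M.
  by apply: lead_diag; apply: scalar_mx_is_diag.
apply: (@lead_inj _ _ _ w2 ((Pmx *m X - q%:M) *m (Pmx *m X + qV%:M))).
  by apply: leadM; [apply: leadB | apply: leadD].
by rewrite [X in lead _ X]hX; apply: lead0.
Qed.

End LeadTensors.

(** * Twisting by a diagonal matrix whose swap is its inverse *)

Section DiagonalTwist.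
Variables (f : 'I_n -> 'I_n -> K) (X Y : 'M[K]_(n * n)).
Hypothesis fN : forall i k : 'I_n, f i k * f k i = 1.
Hypothesis YE : forall i k j l : 'I_n,
  Y (i # k) (j # l) = f i k * X (i # k) (j # l) * f j l.

(** Moving the twist through [Pmx] swaps its tensor factors, which by [fN] inverts it; so [Pmx *m Y]
    is a conjugate of [Pmx *m X]. *)
Lemma Hecke_twist q qV : Hecke q qV X -> Hecke q qV Y.
Proof.
pose D : 'M[K]_(n * n) := diag_mx (\row_x
  f (mxtens_unindex x).1 (mxtens_unindex x).2).
pose D' : 'M[K]_(n * n) := diag_mx (\row_x
  f (mxtens_unindex x).2 (mxtens_unindex x).1).
have DD' : D *m D' = 1%:M.
  rewrite mulmx_diag -diag_const_mx; congr diag_mx; apply/rowP => x.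
  by rewrite !mxE fN.
have D'D : D' *m D = 1%:M.
  rewrite mulmx_diag -diag_const_mx; congr diag_mx; apply/rowP => x.
  by rewrite !mxE fN.
have YD : Y = D *m X *m D.
  apply/matrixP=> x y; rewrite mul_mx_diag mul_diag_mx !mxE.
  case: (mxtens_indexP x) => i k; case: (mxtens_indexP y) => j l.
  by rewrite YE !mxtens_indexK.
have PD : Pmx *m D = D' *m Pmx.
  apply/matrixP=> x y; rewrite mul_mx_diag mul_diag_mx !mxE.
  case: (mxtens_indexP x) => i k; case: (mxtens_indexP y) => j l.
  rewrite PmxE !mxtens_indexK /=; have [->|_] := eqVneq i l; last by rewrite !(mul0r, mulr0).
  by have [->|_] := eqVneq j k; rewrite !(mul0r, mulr0, mulr1, mul1r).
have conj c : D' *m c%:M *m D = c%:M :> 'M[K]_(n * n).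
  by rewrite scalar_mxC -mulmxA D'D mulmx1.
rewrite /Hecke => hX.
have -> : Pmx *m Y = D' *m (Pmx *m X) *m D by rewrite YD !mulmxA PD.
rewrite -(conj q) -(conj qV) -mulmxBl -mulmxBr -mulmxDl -mulmxDr.
rewrite !mulmxA -(mulmxA _ D D') DD' mulmx1 -(mulmxA D').
by rewrite hX mulmx0 mul0mx.
Qed.

Hypothesis Xf : forall i k j l p : 'I_n,
  X (i # k) (j # l) != 0 -> f i p * f k p = f j p * f l p.

(** [Xf] lets the twist factors of the other two legs pass each leg of [X]. Pushed outwards, they
    turn both sides of the equation for [Y] into those for [X] flanked by the same diagonal [g]. *)
Lemma QYBE_twist : QYBE X -> QYBE Y.
Proof.
pose f12 (x : 'I_(n * n * n)) := let y := mxtens_unindex x in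
  f (mxtens_unindex y.1).1 (mxtens_unindex y.1).2.
pose f13 (x : 'I_(n * n * n)) := let y := mxtens_unindex x in
  f (mxtens_unindex y.1).1 y.2.
pose f23 (x : 'I_(n * n * n)) := let y := mxtens_unindex x in
  f (mxtens_unindex y.1).2 y.2.
have Y12 x y : leg12 Y x y = f12 x * leg12 X x y * f12 y.
  case: (mxtens_indexP x) => x' p; case: (mxtens_indexP x') => i k.
  case: (mxtens_indexP y) => y' q; case: (mxtens_indexP y') => j l.
  by rewrite !leg12E YE /f12 !mxtens_indexK /=; ring.
have Y13 x y : leg13 Y x y = f13 x * leg13 X x y * f13 y.
  case: (mxtens_indexP x) => x' p; case: (mxtens_indexP x') => i k.
  case: (mxtens_indexP y) => y' q; case: (mxtens_indexP y') => j l.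
  by rewrite !leg13E YE /f13 !mxtens_indexK /=; ring.
have Y23 x y : leg23 Y x y = f23 x * leg23 X x y * f23 y.
  case: (mxtens_indexP x) => x' p; case: (mxtens_indexP x') => i k.
  case: (mxtens_indexP y) => y' q; case: (mxtens_indexP y') => j l.
  by rewrite !leg23E YE /f23 !mxtens_indexK /=; ring.
(* The relation in [Xf] with the spectator index in the first slot, obtained by inverting both sides
   with [fN]. *)
have fC i k p j l : f i p * f k p = f j p * f l p ->
    f p i * f p k = f p j * f p l.
  move=> e; transitivity (f p i * f p k * (f j p * f p j) * (f l p * f p l)).
    by rewrite !fN !mulr1.
  transitivity (f p i * f p k * f p j * f p l * (f j p * f l p)); first by ring.
  rewrite -e; transitivity (f p j * f p l * (f i p * f p i) * (f k p * f p k)).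
    by ring.
  by rewrite !fN !mulr1.
have X12 x y : leg12 X x y != 0 -> f13 x * f23 x = f13 y * f23 y.
  case: (mxtens_indexP x) => x' p; case: (mxtens_indexP x') => i k.
  case: (mxtens_indexP y) => y' q; case: (mxtens_indexP y') => j l.
  rewrite leg12E /f13 /f23 !mxtens_indexK /=; have [->|_] := eqVneq p q; last first.
    by rewrite mulr0 eqxx.
  by rewrite mulr1; apply: Xf.
have X23 x y : leg23 X x y != 0 -> f12 x * f13 x = f12 y * f13 y.
  case: (mxtens_indexP x) => x' p; case: (mxtens_indexP x') => i k.
  case: (mxtens_indexP y) => y' q; case: (mxtens_indexP y') => j l.
  rewrite leg23E /f12 /f13 !mxtens_indexK /=; have [->|_] := eqVneq i j; last first.
    by rewrite mulr0 eqxx.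
  by rewrite mulr1 => nz; apply: fC; apply: Xf.
(* The spectator of leg 13 sits in the second slot of [f12] but in the first slot of [f23];
   inverting the latter gives this crossed form. *)
have X13 x y : leg13 X x y != 0 -> f12 x * f23 y = f12 y * f23 x.
  case: (mxtens_indexP x) => x' p; case: (mxtens_indexP x') => i k.
  case: (mxtens_indexP y) => y' q; case: (mxtens_indexP y') => j l.
  rewrite leg13E /f12 /f23 !mxtens_indexK /=; have [->|_] := eqVneq k l; last first.
    by rewrite mulr0 eqxx.
  rewrite mulr1 => /(Xf l) e.
  transitivity (f i l * f l q * (f p l * f l p)); first by rewrite fN mulr1.
  transitivity (f i l * f p l * (f l q * f l p)); first by ring.
  rewrite e; transitivity (f j l * f l p * (f q l * f l q)); first by ring.
  by rewrite fN mulr1.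
pose g x := f12 x * f13 x * f23 x.
have E1 x y : (leg12 Y *m leg13 Y *m leg23 Y) x y
    = g x * (leg12 X *m leg13 X *m leg23 X) x y * g y.
  rewrite !mxE mulr_sumr mulr_suml; apply: eq_bigr => b _.
  rewrite !mxE !mulr_suml mulr_sumr mulr_suml; apply: eq_bigr => a _.
  rewrite Y12 Y13 Y23 /g.
  have [->|/X12 e12] := eqVneq (leg12 X x a) 0; first by ring.
  have [->|/X13 e13] := eqVneq (leg13 X a b) 0; first by ring.
  have [->|/X23 e23] := eqVneq (leg23 X b y) 0; first by ring.
  (* On the path [x], [a], [b], [y] the twist values at the inner points are traded for values at
     the two ends. *)
  set P := leg12 X x a; set Q := leg13 X a b; set S := leg23 X b y.
  transitivity (P * Q * S * f12 x * (f12 a * f23 b) * f13 a * f13 b * f23 y); first by ring.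
  rewrite e13.
  transitivity (P * Q * S * f12 x * (f13 a * f23 a) * (f12 b * f13 b) * f23 y); first by ring.
  by rewrite -e12 e23; ring.
have E2 x y : (leg23 Y *m leg13 Y *m leg12 Y) x y
    = g x * (leg23 X *m leg13 X *m leg12 X) x y * g y.
  rewrite !mxE mulr_sumr mulr_suml; apply: eq_bigr => b _.
  rewrite !mxE !mulr_suml mulr_sumr mulr_suml; apply: eq_bigr => a _.
  rewrite Y12 Y13 Y23 /g.
  have [->|/X23 e23] := eqVneq (leg23 X x a) 0; first by ring.
  have [->|/X13 e13] := eqVneq (leg13 X a b) 0; first by ring.
  have [->|/X12 e12] := eqVneq (leg12 X b y) 0; first by ring.
  set P := leg23 X x a; set Q := leg13 X a b; set S := leg12 X b y.
  transitivity (P * Q * S * f23 x * (f12 b * f23 a) * f13 a * f13 b * f12 y); first by ring.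
  rewrite -e13.
  transitivity (P * Q * S * f23 x * (f12 a * f13 a) * (f13 b * f23 b) * f12 y); first by ring.
  by rewrite -e23 e12; ring.
by rewrite /QYBE => e; apply/matrixP => x y; rewrite E1 E2 e.
Qed.

End DiagonalTwist.

End TensorEntries.

(** * Exponentials *)

Section QExponential.
Variable R : realType.
Local Notation C := R[i].
Implicit Types x y : C.

Lemma qpowD x y : qpow (x + y) = qpow x * qpow y.
Proof.
apply: fpsP => m.
change ((x + y) ^+ m / m`!%:R = \sum_(j < m.+1) (x ^+ j / j`!%:R) * (y ^+ (m - j) / (m - j)`!%:R)).
rewrite exprDn mulr_suml (reindex_inj rev_ord_inj) /=; apply: eq_bigr => j _.
have jm : (j <= m)%N by rewrite -ltnS.
rewrite subSS subKn // bin_sub // -mulr_natr.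
have nz k : k`!%:R != 0 :> C by rewrite pnatr_eq0 -lt0n fact_gt0.
rewrite -(bin_fact jm) !natrM.
have nzb : 'C(m, j)%:R != 0 :> C by rewrite pnatr_eq0 -lt0n bin_gt0.
by field; rewrite nzb !nz.
Qed.

Lemma qpow0 : qpow 0 = 1 :> fps C.
Proof.
apply: fpsP => -[|m]; first by rewrite /= expr0 fact0 divr1.
by rewrite /= expr0n mul0r.
Qed.

Lemma qpowNK x : qpow x * qpow (- x) = 1.
Proof. by rewrite -qpowD subrr qpow0. Qed.

Lemma expr_diag_mx m (X : 'M[C]_m) k i j :
  is_diag_mx X -> (X ^+ k) i j = X i i ^+ k *+ (i == j).
Proof.
move=> dX; elim: k i j => [|k IH] i j; first by rewrite !expr0 [LHS]mxE.
rewrite exprS [LHS]mxE (bigD1 i) //= IH big1 => [|l li]; last first.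
  by rewrite (is_diag_mxP dX) ?mul0r // eq_sym.
by rewrite addr0 exprS mulrnAr.
Qed.

Lemma qexp_diag m (X : 'M[C]_m) :
  is_diag_mx X -> qexp X = diag_mx (\row_i qpow (X i i)).
Proof.
move=> dX; apply/matrixP => i j; rewrite !mxE; apply: fpsP => k /=.
rewrite expr_diag_mx //; have [->|ne] := eqVneq i j; first by [].
by rewrite mulr0n mul0r.
Qed.

End QExponential.

(** * Weights on Belavin-Drinfeld triples *)

Section Weights.
Variables (R : realType) (n : nat).
Local Notation C := R[i].
Local Notation root := ('I_n * 'I_n)%type.
Local Notation vec := (@vec R n).
Local Notation simple_roots := (simple_roots n).
Implicit Types (r s t a : root) (T : bd_triple R n) (h : 'I_n -> C).

Lemma G1_simple T : {subset G1 T <= simple_roots}.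
Proof. by case: T => ? ? ? /= sG *; apply/subsetP. Qed.

Lemma tau_G2 T t : t \in G1 T -> tau T t \in G2 T.
Proof. by case: T => G1 G2 tau /= _ _ _ <- _ _; apply: imset_f. Qed.

Lemma G2_simple T : {subset G2 T <= simple_roots}.
Proof. by case: T => ? ? ? /= _ sG *; apply/subsetP. Qed.

Lemma dot_tau T : {in G1 T &, forall r s,
  dot (vec (tau T r)) (vec (tau T s)) = dot (vec r) (vec s)}.
Proof. by case: T. Qed.

Lemma tau_nilpotent T t : exists k, iter k (tau T) t \notin G1 T.
Proof.
case: (boolP (t \in G1 T)) => [|nt]; last by exists 0%N.
by case: T => G1 G2 tau /= _ _ _ _ _; apply.
Qed.

Lemma simple_positive t : t \in simple_roots -> positive t.
Proof. by rewrite inE /positive => /eqP ->. Qed.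

Lemma simple_eq a t : a \in simple_roots -> t \in simple_roots ->
  (a == t) = (a.1 == t.1).
Proof.
case: a t => [a1 a2] [t1 t2]; rewrite !inE /= xpair_eqE => /eqP ea /eqP et.
case: eqVneq => [e|] //=; apply/eqP/val_inj => /=; by rewrite ea et e.
Qed.

Definition lin h (v : 'rV[C]_n) : C := \sum_i h i * v 0 i.
Definition weight h r : C := h r.1 - h r.2.

Lemma lin_vec h r : lin h (vec r) = weight h r.
Proof.
rewrite /lin /vec /weight -(sum_delta h r.1) -(sum_delta h r.2) -sumrB.
apply: eq_bigr => i _.
by rewrite !mxE eqxx !(eq_sym i) /= mulrBr.
Qed.

Lemma lin_sum h (c : root -> nat) (P : pred root) (f : root -> root) :
  lin h (\sum_(t | P t) vec (f t) *+ c t) = \sum_(t | P t) weight h (f t) *+ c t.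
Proof.
rewrite /lin; transitivity (\sum_i \sum_(t | P t) (h i * vec (f t) 0 i) *+ c t).
  apply: eq_bigr => i _; rewrite summxE mulr_sumr; apply: eq_bigr => t _.
  by rewrite mulmxnE mulrnAr.
rewrite exchange_big /=; apply: eq_bigr => t _.
by rewrite -lin_vec /lin sumrMnl.
Qed.

(* The functional h whose weight is the coefficient of the k-th simple root. *)
Definition part (k : nat) : 'I_n -> C := fun i => (i <= k)%:R.

Lemma weight_part k r : positive r -> weight (part k) r = (r.1 <= k < r.2)%:R.
Proof.
rewrite /positive /weight /part => lt; rewrite ltnNge.
case: (leqP r.2 k) => [le|_]; last by rewrite andbT subr0.
by rewrite (leq_trans (ltnW lt) le) subrr.
Qed.

Lemma weight_part_simple k t : t \in simple_roots ->
  weight (part k) t = (t.1 == k :> nat)%:R.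
Proof.
move=> st; rewrite weight_part ?simple_positive //.
by move: st; rewrite inE => /eqP ->; rewrite ltnS -eqn_leq.
Qed.

(** The coefficients on the simple roots are the indicator of the interval from [r.1] to [r.2], and
    this interval recovers both ends. *)
Lemma vec_inj_pos r s : positive r -> positive s -> vec r = vec s -> r = s.
Proof.
move=> pr ps e.
have E k : (r.1 <= k < r.2)%N = (s.1 <= k < s.2)%N.
  have := congr1 (lin (part k)) e; rewrite !lin_vec !weight_part //.
  by move/eqP; rewrite eqr_nat; do 2!case: (_ && _).
move: pr ps E; case: r s {e} => [r1 r2] [s1 s2]; rewrite /positive /= => pr ps E.
have e1 : r1 = s1.
  apply/val_inj/eqP; rewrite eqn_leq /=.
  have := E r1; have := E s1; rewrite !leqnn pr ps /= => /andP[-> _] /esym/andP[-> _].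
  by [].
rewrite e1; congr (_, _); apply/val_inj/eqP; rewrite eqn_leq /= (leqNgt r2) (leqNgt s2).
apply/andP; split; apply/negP => lt.
  by have := E s2; rewrite lt ltnn e1 (ltnW ps) andbF.
by have := E r2; rewrite lt ltnn -e1 (ltnW pr) andbF.
Qed.

Lemma pos_span_positive (Y : {set root}) r : r \in pos_span R Y -> positive r.
Proof. by rewrite inE => /andP[]. Qed.

Lemma pos_span_sum (Y : {set root}) (P : pred root) (c : root -> nat) (f : root -> root) r :
  positive r -> vec r = \sum_(t | P t) vec (f t) *+ c t ->
  (forall t, P t -> f t \in Y) -> r \in pos_span R Y.
Proof.
move=> pr e fY; rewrite inE pr e; apply: memv_suml => t /fY tY.
by apply: rpredMn; apply: memv_span; apply/mapP; exists (f t); rewrite ?mem_enum.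
Qed.

Lemma simple_pos_span T t : t \in G1 T -> t \in pos_span R (G1 T).
Proof.
move=> tG; rewrite inE (simple_positive (G1_simple tG)).
by apply: memv_span; apply/mapP; exists t; rewrite ?mem_enum.
Qed.

(** * Supports of roots and orbits of simple roots under [tau] *)

Section Supports.
Variable T : bd_triple R n.

Definition in_supp a r := (r.1 <= a.1 < r.2)%N.

(** Coefficients are compared at one simple root at a time. A nonzero coefficient of [a] in [r]
    forces [c a] to be nonzero, and the coefficient of [tau T a] in [s] cannot cancel because every
    [c t] is a natural number. *)
Lemma supp_step r s a : tau_ext T r s -> a \in simple_roots -> in_supp a r ->
  a \in G1 T /\ in_supp (tau T a) s.
Proof.
case=> /pos_span_positive pr /pos_span_positive ps [c [er es]] sa ar.
have := congr1 (lin (part a.1)) er.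
rewrite lin_vec weight_part // -/(in_supp a r) ar (lin_sum _ _ _ id) => er'.
have [/andP[aG ca]|na] := boolP ((a \in G1 T) && (c a != 0)%N); last first.
  suff e0 : true%:R = 0 :> C by move/eqP: e0; rewrite oner_eq0.
  rewrite er' big1 // => t tG.
  rewrite weight_part_simple ?(G1_simple tG) // eq_sym.
  rewrite -[_ == _ :> nat]/(a.1 == t.1) -(simple_eq sa (G1_simple tG)).
  case: (eqVneq a t) na tG => [<-|_ _ _]; last by rewrite mul0rn.
  by move=> + aG; rewrite aG negbK => /eqP ->.
split=> //; have /eqP := congr1 (lin (part (tau T a).1)) es.
rewrite lin_vec weight_part // (lin_sum _ _ _ (tau T)).
rewrite -/(in_supp (tau T a) s); case: (in_supp _ _) => //.
rewrite eq_sym psumr_eq0 => [|t tG]; last first.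
  by rewrite mulrn_wge0 // weight_part_simple ?ler0n //; apply/G2_simple/tau_G2.
move=> /allP/(_ a); rewrite mem_index_enum => /(_ isT); rewrite aG /=.
rewrite weight_part_simple; last by apply/G2_simple/tau_G2.
by rewrite eqxx pnatr_eq0 (negPf ca).
Qed.

(** Comparing coefficients forces [c] to be the indicator of [a] on [G1 T], so the relation is
    single-valued at simple roots. *)
Lemma tau_ext_simple a s : a \in simple_roots -> tau_ext T a s -> s = tau T a.
Proof.
move=> sa as_; have aG : a \in G1 T.
  have aa : in_supp a a by rewrite /in_supp leqnn; apply: (simple_positive sa).
  by have [] := supp_step as_ sa aa.
case: as_ => pa /pos_span_positive ps [c [ea es]].
apply: vec_inj_pos => //; first exact/simple_positive/G2_simple/tau_G2.
have cE t : t \in G1 T -> c t = (a == t).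
  move=> tG; have := congr1 (lin (part t.1)) ea.
  rewrite lin_vec weight_part_simple // (lin_sum _ _ _ id).
  rewrite (bigD1 t) //= big1 => [|u /andP[uG ut]]; last first.
    rewrite weight_part_simple ?(G1_simple uG) //.
    rewrite -[_ == _ :> nat]/(u.1 == t.1) -simple_eq ?(G1_simple uG) ?(G1_simple tG) //.
    by rewrite (negPf ut) mul0rn.
  rewrite weight_part_simple ?(G1_simple tG) // eqxx addr0 => /eqP.
  rewrite -[X in _ == X]mulr_natr mul1r eqr_nat => /eqP <-.
  by rewrite (simple_eq sa (G1_simple tG)).
rewrite es (bigD1 a) //= cE // eqxx mulr1n big1 ?addr0 // => t /andP[tG].
by rewrite cE // eq_sym => /negPf ->; rewrite mulr0n.
Qed.

Lemma tau_ext_tau a : a \in G1 T -> tau_ext T a (tau T a).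
Proof.
move=> aG; split; first exact: simple_pos_span.
  have sa := simple_positive (G2_simple (tau_G2 aG)).
  rewrite inE sa; apply: memv_span; apply/mapP; exists (tau T a) => //.
  by rewrite mem_enum tau_G2.
exists (fun t => (t == a : nat)); split.
  rewrite (bigD1 a) //= eqxx mulr1n big1 ?addr0 // => t /andP[_ /negPf ->].
  by rewrite mulr0n.
rewrite (bigD1 a) //= eqxx mulr1n big1 ?addr0 // => t /andP[_ /negPf ->].
by rewrite mulr0n.
Qed.

Lemma tau_pow_iter p r s a : tau_pow T p r s -> a \in simple_roots ->
  in_supp a r -> forall k, (k < p)%N -> iter k (tau T) a \in G1 T.
Proof.
elim: p r a => // p IH r a [r1 rr1 r1s] sa ar [|k] kp.
  by have [] := supp_step rr1 sa ar.
have [aG ar1] := supp_step rr1 sa ar.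
by rewrite iterSr; apply: (IH r1) => //; apply/G2_simple/tau_G2.
Qed.

Definition exit_time a := ex_minn (tau_nilpotent T a).

(** Every simple root in the support of [r] survives [p] steps, in particular the one starting at
    [r.1], and its exit time is finite by nilpotency. *)
Lemma tau_pow_bound p r s : tau_pow T p r s ->
  (p <= \max_(a : root) exit_time a)%N.
Proof.
case: p => // p H; have [r1 [rG _ _] _] := H.
have pr := pos_span_positive rG.
have a2P : (r.1.+1 < n)%N by apply: leq_ltn_trans (ltn_ord r.2).
pose a : root := (r.1, Ordinal a2P).
have sa : a \in simple_roots by rewrite inE.
have ar : in_supp a r by rewrite /in_supp leqnn.
have it := tau_pow_iter H sa ar.
apply: leq_trans (leq_bigmax a); rewrite /exit_time; case: ex_minnP => m nm _.
by rewrite leqNgt; apply/negP => /it; rewrite (negPf nm).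
Qed.

(** The uniform bound on exponents makes the maximum in [depth] exist, so [xget] returns a genuine
    maximum and not its default. *)
Lemma tau_pow_depth p r s : (0 < p)%N -> tau_pow T p r s -> (p <= depth T)%N.
Proof.
move=> p0 H; have def : tau_pow_defined T p.
  by case: p p0 H => // p _ H; have [t [rG _ _] _] := H; exists r => //; exists s.
pose B := \max_(a : root) exit_time a.
have ex : exists p, `[< tau_pow_defined T p >] by exists p; apply/asboolP.
have bd q : `[< tau_pow_defined T q >] -> (q <= B)%N.
  by move/asboolP => [u _ [v]]; apply: tau_pow_bound.
have [d /asboolP dd dmax] := ex_maxnP ex bd.
rewrite /depth; set S := (X in classical_sets.xget _ X).
have [] : S (classical_sets.xget 0%N S).
  by apply: classical_sets.xgetPex; exists d; split=> // q /asboolP; apply: dmax.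
by move=> _; apply.
Qed.

Lemma exit_timeS t : t \in G1 T -> exit_time t = (exit_time (tau T t)).+1.
Proof.
move=> tG; rewrite /exit_time.
case: ex_minnP => -[|k]; first by rewrite /= tG.
rewrite iterSr => nk kmin; case: ex_minnP => m nm mmin; congr S.
by apply/eqP; rewrite eqn_leq mmin // andbT -ltnS kmin // iterSr.
Qed.

(* Nilpotency of tau makes the equations weight h t - weight h (tau t) = x t solvable
   by summing x along the tau-orbit of t. *)
Lemma exists_weight (x : root -> C) : exists h : 'I_n -> C,
  {in G1 T, forall t, weight h t - weight h (tau T t) = x t}.
Proof.
pose g t := \sum_(k < exit_time t) x (iter k (tau T) t).
(* Minus the partial sums of [g]: the difference of [h] across a simple root [t] is then exactly
   [g t]. *)
pose h (i : 'I_n) := - \sum_(t in simple_roots | (t.1 < i)%N) g t.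
have hE t : t \in simple_roots -> weight h t = g t.
  move=> st; have t2 : t.2 = t.1.+1 :> nat by move: st; rewrite inE => /eqP.
  rewrite /weight /h opprK addrC (bigD1 t) /=; last by rewrite st t2 leqnn.
  rewrite -addrA; set S := (X in g t + (X - _)).
  suff -> : S = \sum_(u in simple_roots | (u.1 < t.1)%N) g u.
    by rewrite subrr addr0.
  apply: eq_bigl => u; case: (boolP (u \in simple_roots)) => //= su.
  by rewrite t2 ltnS simple_eq // andbC -ltn_neqAle.
exists h => t tG; rewrite !hE ?(G1_simple tG) //; last exact/G2_simple/tau_G2.
rewrite /g exit_timeS // big_ord_recl /=.
under eq_bigr do rewrite -iterS iterSr.
by rewrite addrK.
Qed.

End Supports.

(** * Powers of [tau] and of its restriction, compared through the weight [h] *)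

Section Subtriple.
Variables (T' T : bd_triple R n) (h : 'I_n -> C).
Hypothesis sub : bd_sub T' T.
Hypothesis hh : {in G1 T, forall t,
  weight h t - weight h (tau T t) = (t \notin G1 T')%:R}.

Lemma G1_sub : {subset G1 T' <= G1 T}.
Proof. by case: sub => /subsetP. Qed.

Lemma tau_sub t : t \in G1 T' -> tau T' t = tau T t.
Proof. by case: sub => _; apply. Qed.

Lemma tau_ext_sub r s : tau_ext T' r s -> tau_ext T r s.
Proof.
case=> rG sG [c [er es]].
pose c' t := if t \in G1 T' then c t else 0%N.
have red (F : root -> 'rV[C]_n) :
    \sum_(t in G1 T') F t *+ c t = \sum_(t in G1 T) F t *+ c' t.
  rewrite [RHS](bigID [in G1 T']) /= [X in _ + X]big1 => [|t /andP[_ /negPf nt]].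
    rewrite addr0; apply: eq_big => [t|t tG]; last by rewrite /c' tG.
    by rewrite andbC; case: (boolP (t \in G1 T')) => // /G1_sub ->.
  by rewrite /c' nt mulr0n.
have es' : vec s = \sum_(t in G1 T') vec (tau T t) *+ c t.
  by rewrite es; apply: eq_bigr => t tG; rewrite tau_sub.
split; last by exists c'; rewrite er es' !red.
  by apply: (pos_span_sum (pos_span_positive rG) er) => t; apply: G1_sub.
apply: (pos_span_sum (pos_span_positive sG) es') => t tG.
exact/tau_G2/G1_sub.
Qed.

Lemma tau_pow_sub p r s : tau_pow T' p r s -> tau_pow T p r s.
Proof.
by elim: p r => // p IH r [t /tau_ext_sub rt /IH ts]; exists t.
Qed.

(** The drop in weight is the sum of [c t] over the [t] in [G1 T] outside [G1 T']. If it is 0, then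
    [c] lives on [G1 T'] and witnesses the relation for [T']. *)
Lemma tau_ext_weight r s : tau_ext T r s -> weight h s <= weight h r /\
  (weight h s = weight h r -> tau_ext T' r s).
Proof.
case=> rG sG [c [er es]].
have wr : weight h r = \sum_(t in G1 T) weight h t *+ c t.
  by rewrite -lin_vec er (lin_sum _ _ _ id).
have ws : weight h s = \sum_(t in G1 T) weight h (tau T t) *+ c t.
  by rewrite -lin_vec es lin_sum.
have dE : weight h r - weight h s = \sum_(t in G1 T) (t \notin G1 T')%:R *+ c t.
  by rewrite wr ws -sumrB; apply: eq_bigr => t tG; rewrite -mulrnBl hh.
split.
  by rewrite -subr_ge0 dE; apply: sumr_ge0 => t _; rewrite mulrn_wge0 ?ler0n.
move=> e; move/esym/eqP: dE; rewrite e subrr psumr_eq0; last first.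
  by move=> t _; rewrite mulrn_wge0 ?ler0n.
move=> /allP c0.
have {}c0 t : t \in G1 T -> t \notin G1 T' -> c t = 0%N.
  move=> tG nt; have := c0 t (mem_index_enum t).
  by rewrite tG nt /= pnatr_eq0 => /eqP.
have red (F : root -> 'rV[C]_n) :
    \sum_(t in G1 T) F t *+ c t = \sum_(t in G1 T') F t *+ c t.
  rewrite (bigID [in G1 T']) /= [X in _ + X]big1 => [|t /andP[tG nt]]; last first.
    by rewrite c0 // mulr0n.
  rewrite addr0; apply: eq_bigl => t.
  by rewrite andbC; case: (boolP (t \in G1 T')) => // /G1_sub ->.
have er' := er; rewrite red in er'.
have es' : vec s = \sum_(t in G1 T') vec (tau T' t) *+ c t.
  by rewrite es red; apply: eq_bigr => t tG; rewrite tau_sub.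
split; last by exists c.
  exact: (pos_span_sum (pos_span_positive rG) er').
by apply: (pos_span_sum (pos_span_positive sG) es') => t; apply: tau_G2.
Qed.

(** No step raises the weight, so equal weights at the ends mean that no step lowers it and each one
    belongs to [T']. *)
Lemma tau_pow_weight p r s : tau_pow T p r s -> weight h s <= weight h r /\
  (weight h s = weight h r -> tau_pow T' p r s).
Proof.
elim: p r => [|p IH] r; first by move=> ->.
case=> t /tau_ext_weight[le rt] /IH[le' ts]; split; first exact: le_trans le.
move=> e; have e1 : weight h t = weight h r.
  by apply/eqP; rewrite eq_le le -e le'.
by exists t; [apply: rt | apply: ts; rewrite e1].
Qed.

Lemma tau_pow_sub_eq p r s : tau_pow T' p r s -> weight h s = weight h r.
Proof.
elim: p r => [|p IH] r; first by move=> ->.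
case=> t [_ _ [c [er es]]] /IH ->.
rewrite -!lin_vec er es (lin_sum _ _ _ id) lin_sum; apply: eq_bigr => a aG.
congr (_ *+ _); apply/esym/eqP; rewrite -subr_eq0 tau_sub // hh ?G1_sub //.
by rewrite aG.
Qed.

Lemma tau_powP p r s :
  tau_pow T' p r s <-> tau_pow T p r s /\ weight h s = weight h r.
Proof.
split=> [H|[H]]; first by split; [apply: tau_pow_sub|apply: tau_pow_sub_eq H].
by have [_] := tau_pow_weight H.
Qed.

Lemma precP r s : prec T' r s <-> prec T r s /\ weight h s = weight h r.
Proof.
split=> [[p p1 /tau_powP[H e]]|[[p p1 H] e]]; first by split=> //; exists p.
by exists p => //; apply/tau_powP.
Qed.

Lemma prec_weight r s : prec T r s -> weight h s <= weight h r.
Proof. by case=> p _ /tau_pow_weight[]. Qed.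

(** A simple root in the support of [r] is carried along by the steps of [T'], hence stays in
    [G1 T'], where both maps agree. This is what fixes the orientation in [prec_left] and
    [prec_right]. *)
Lemma tau_pow_supp p r s a b : tau_pow T' p r s -> a \in simple_roots ->
  in_supp a r -> tau_pow T p a b -> tau_pow T' p a b.
Proof.
elim: p r a => // p IH r a [r1 rr1 r1s] sa ar [a1 aa1 a1b].
have [aG ar1] := supp_step rr1 sa ar.
have e1 := tau_ext_simple sa aa1; rewrite e1 -tau_sub // in a1b.
exists (tau T' a); first exact: tau_ext_tau.
by apply: IH r1s _ ar1 a1b; apply/G2_simple/tau_G2.
Qed.

Lemma in_supp_head a r p s : (0 < p)%N -> tau_pow T' p r s -> a.1 = r.1 -> in_supp a r.
Proof.
case: p => // p _ [t [/pos_span_positive pr _ _] _] e.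
by rewrite /in_supp e leqnn.
Qed.

Lemma prec_left_sub r s : prec T' r s -> prec_left T' r s <-> prec_left T r s.
Proof.
move=> /precP[rs e]; split=> -[ht [p p1 [H [a [b [sa sb ea eb ab]]]]]]; split=> //.
  exists p => //; split; first exact: tau_pow_sub.
  by exists a, b; split=> //; apply: tau_pow_sub.
(* The exponent [p] comes from the orientation witness; equality of weights gives the relation for
   [T'] at any exponent. *)
have H' : tau_pow T' p r s by apply/tau_powP.
exists p => //; split=> //; exists a, b; split=> //.
exact: tau_pow_supp H' sa (in_supp_head p1 H' ea) ab.
Qed.

Lemma prec_right_sub r s : prec T' r s -> prec_right T' r s <-> prec_right T r s.
Proof.
move=> /precP[rs e]; split=> -[ht [p p1 [H [a [b [sa sb ea eb ab]]]]]]; split=> //.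
  exists p => //; split; first exact: tau_pow_sub.
  by exists a, b; split=> //; apply: tau_pow_sub.
have H' : tau_pow T' p r s by apply/tau_powP.
exists p => //; split=> //; exists a, b; split=> //.
exact: tau_pow_supp H' sa (in_supp_head p1 H' ea) ab.
Qed.

Lemma sign_sub r s : prec T' r s -> sign T r s = sign T' r s.
Proof.
move=> rs; rewrite /sign (asbool_equiv_eq (prec_left_sub rs)).
by rewrite (asbool_equiv_eq (prec_right_sub rs)).
Qed.

(** The weight of [t] is squeezed between two equal weights. Hence the existential terms of [Kexp]
    are the same for both triples. *)
Lemma prec_between r s t : prec T' r s ->
  prec T r t /\ prec T t s <-> prec T' r t /\ prec T' t s.
Proof.
move=> /precP[_ e]; split=> -[rt ts]; last first.
  by move/precP: rt => [? _]; move/precP: ts => [? _].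
have le1 := prec_weight rt; have le2 := prec_weight ts.
have e1 : weight h t = weight h r by apply/eqP; rewrite eq_le le1 -e le2.
by split; apply/precP; split=> //; rewrite e1.
Qed.

Lemma Kexp_sub r s : prec T' r s -> Kexp T r s = Kexp T' r s.
Proof.
move=> rs; rewrite /Kexp (asbool_equiv_eq (prec_left_sub rs)).
have E (P : root -> Prop) :
    (exists t, [/\ prec T r t, prec T t s & P t])
    <-> (exists t, [/\ prec T' r t, prec T' t s & P t]).
  split=> -[t [rt ts Pt]]; exists t.
    by have [|? ?] := (prec_between t rs).1.
  by have [|? ?] := (prec_between t rs).2.
by rewrite (asbool_equiv_eq (E (fun t => precdot r t)))
           (asbool_equiv_eq (E (fun t => precdot t r))).
Qed.

End Subtriple.
End Weights.

(** * Weight-0 parts of the R-matrices *)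

Section LeadingParts.
Variables (R : realType) (n : nat).
Local Notation C := R[i].
Local Notation A := (fps R[i]).
Local Notation root := ('I_n * 'I_n)%type.
Local Notation "x # y" := (mxtens_index (x, y)) (at level 30).
Implicit Types (r s : root) (T : bd_triple R n).

Section Invariant.
Variable h : 'I_n -> C.
Local Notation w2 := (wtens h h).

Lemma lead_rs : lead w2 (rs R n) (rs R n).
Proof.
apply: leadD.
  by apply/leadZ/lead_sum => i _; apply: lead_tens_eq.
by apply: lead_sum => r _; apply: lead_tens_eq; rewrite addrC.
Qed.

Lemma lead_Rs : lead w2 (Rs R n) (Rs R n).
Proof.
apply: leadD; first apply: leadD.
- by apply/leadZ/lead_sum => i _; apply: lead_tens_eq.
- by apply: lead_sum => i _; apply: lead_sum => j _; apply: lead_tens_eq.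
apply/leadZ; apply: lead_sum => i _; apply: lead_sum => j _.
by apply: lead_tens_eq; rewrite addrC.
Qed.

(** For both tensors, row weight minus column weight is [weight h s - weight h r]. *)
Lemma lead_tensor_roots (K : comNzRingType) r s : weight h s <= weight h r ->
  lead w2 (Eroot K s *t Eneg K r)
          (if weight h s == weight h r then Eroot K s *t Eneg K r else 0)
  /\ lead w2 (Eneg K r *t Eroot K s)
          (if weight h s == weight h r then Eneg K r *t Eroot K s else 0).
Proof.
rewrite /weight => le; case: eqVneq => [e|ne].
  have e' : h s.1 + h r.2 = h s.2 + h r.1.
    by move/eqP: e; rewrite subr_eq addrAC eq_sym subr_eq [h r.1 + _]addrC => /eqP ->.
  by split; apply: lead_tens_eq; rewrite // addrC e' addrC.
have lt : h s.1 + h r.2 < h s.2 + h r.1.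
  by rewrite [ltRHS]addrC -ltrBlDr addrAC -ltrBrDr lt_neqAle ne.
by split; apply: lead_tens_lt; rewrite // addrC [ltRHS]addrC.
Qed.

End Invariant.

Section Subtriple.
Variables (T' T : bd_triple R n) (h : 'I_n -> C).
Hypothesis sub : bd_sub T' T.
Hypothesis hh : {in G1 T, forall t,
  weight h t - weight h (tau T t) = (t \notin G1 T')%:R}.
Local Notation w2 := (wtens h h).

Lemma lead_amx : lead w2 (amx T) (amx T').
Proof.
apply: lead_sum => r _; apply: lead_sum_cond => [s /asboolP|s /asboolP rs|s /asboolP rs].
- by move=> /(precP sub hh)[? _]; apply/asboolP.
- rewrite (sign_sub sub hh rs); apply: leadZ.
  have /(precP sub hh)[rs' e] := rs.
  have [] := lead_tensor_roots C (prec_weight sub hh rs'); rewrite e eqxx.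
  by move=> ? ?; apply: leadB.
(* For a pair related under [T] only, the weights differ by [precP]. Writing 0 as a multiple of
   [0 - 0] matches the two halves of the wedge, each of strictly negative weight. *)
move=> /asboolP nrs; rewrite -(scaler0 _ (sign T r s)) -(subrr 0); apply: leadZ.
have [] := lead_tensor_roots C (prec_weight sub hh rs).
case: eqP => [e|_]; last by move=> ? ?; apply: leadB.
by case: nrs; apply/(precP sub hh).
Qed.

Lemma lead_eps : lead w2 (eps T) (eps T').
Proof.
have [la lr] := (lead_amx, lead_rs h).
by apply: leadD; [apply: leadD|]; apply: leadM.
Qed.

Lemma lead_a_tilde : lead w2 (a_tilde T) (a_tilde T').
Proof.
apply: (lead_map2 (phi := fun x y => fps_const x * qpow (x * y))) lead_amx lead_eps.
move=> y; have -> : fps_const 0 = 0 :> A by apply: fpsP => -[].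
by rewrite mul0r.
Qed.

Lemma lead_Rbar_GGS : lead w2 (Rbar_GGS T) (Rbar_GGS T').
Proof. by apply: leadD; [apply: lead_Rs | apply/leadZ/lead_a_tilde]. Qed.

Lemma lead_Apow p : (0 < p)%N -> lead w2 (Apow T p) (Apow T' p).
Proof.
move=> p0; apply: leadZ.
apply: lead_sum => r _; apply: lead_sum_cond => [s /asboolP|s /asboolP rs|s /asboolP rs].
- by move=> /(tau_powP sub hh)[? _]; apply/asboolP.
- have prs : prec T' r s by exists p.
  rewrite (sign_sub sub hh prs) (Kexp_sub sub hh prs); apply: leadZ.
  have /(precP sub hh)[rs' e] := prs.
  by have [+ _] := lead_tensor_roots A (prec_weight sub hh rs'); rewrite e eqxx.
move=> /asboolP nrs.
rewrite -(scaler0 _ (fps_const (sign T r s) * qpow (Kexp T r s))).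
apply: leadZ; have prs : prec T r s by exists p.
have [+ _] := lead_tensor_roots A (prec_weight sub hh prs).
case: eqP => // e _; case: nrs; exact/(tau_powP sub hh).
Qed.

End Subtriple.

(** * The product [Jmx]: padding, weight-0 part and invertibility *)

Lemma Apow_depth T p : (depth T < p)%N -> Apow T p = 0.
Proof.
move=> dp; rewrite /Apow big1 ?scaler0 // => r _.
rewrite big1 // => s /asboolP rs.
have := tau_pow_depth (leq_ltn_trans (leq0n _) dp) rs.
by rewrite leqNgt dp.
Qed.

(** The depths of [T] and [T'] may differ; padding with trivial factors lets the two products be
    compared factor by factor. *)
Lemma Jmx_widen T D : (depth T <= D)%N ->
  Jmx T = \big[mulmx/1%:M]_(1 <= p < D.+1) Jpow T p.
Proof.
move=> le; rewrite /Jmx /index_iota !subSS !subn0 -[in RHS](subnKC le) iotaD.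
rewrite big_cat_nested; congr (bigop _ _ _); rewrite big_seq.
elim/big_rec: _ => // p X; rewrite mem_iota => /andP[dp _] <-.
by rewrite /Jpow Apow_depth ?addr0 ?mul1mx.
Qed.

Lemma lead_Jmx T' T (h : 'I_n -> C) : bd_sub T' T ->
  {in G1 T, forall t, weight h t - weight h (tau T t) = (t \notin G1 T')%:R} ->
  lead (wtens h h) (Jmx T) (Jmx T').
Proof.
move=> sub hh; rewrite (Jmx_widen (leq_maxl (depth T) (depth T'))).
rewrite (Jmx_widen (leq_maxr (depth T) (depth T'))).
apply: lead_prod => p; rewrite mem_index_iota => /andP[p0 _].
apply: leadD; last exact: lead_Apow.
by apply: lead_diag; apply: scalar_mx_is_diag.
Qed.

(** As [p] is at least 1, [s] is a positive root, so the first tensor index strictly grows from row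
    to column; it dominates the lexicographic order of index pairs. *)
Lemma Apow_upper T p (x y : 'I_(n * n)) : (0 < p)%N -> (y <= x)%N -> Apow T p x y = 0.
Proof.
move=> p0 yx; rewrite mxE summxE big1 ?mulr0 // => r _.
rewrite summxE big1 // => s /asboolP rs; rewrite mxE.
suff -> : (Eroot A s *t Eneg A r) x y = 0 by rewrite mulr0.
apply/eqP; apply: contraTT yx => /lead_tensE[-> ->] /=; rewrite -ltnNge.
have ps : (s.1 < s.2)%N.
  case: p p0 rs => // p _; elim: p r => [|p IH] r [t [_ sG _]]; last exact: IH.
  by move=> <-; apply: (pos_span_positive sG).
apply: (@leq_trans (s.1.+1 * n)); first by rewrite mulSn addnC ltn_add2r.
by rewrite (leq_trans _ (leq_addr _ _)) // leq_mul2r ps orbT.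
Qed.

(** Each factor is upper unitriangular, hence of determinant 1. So [invmx] in [Rbar_J] is a true
    inverse. *)
Lemma Jmx_unit T : Jmx T \in unitmx.
Proof.
rewrite /Jmx big_nat; elim/big_rec: _ => [|p X /andP[p0 _] uX]; first exact: unitmx1.
have JE (x y : 'I_(n * n)) : (y <= x)%N -> Jpow T p x y = (x == y)%:R.
  by move=> yx; rewrite [LHS]mxE Apow_upper // addr0 mxE.
rewrite unitmx_mul uX andbT unitmxE -det_tr det_trig.
  by rewrite big1 ?unitr1 // => x _; rewrite [LHS]mxE JE ?eqxx.
by apply/is_trig_mxP => x y xy; rewrite [LHS]mxE JE ?(ltnW xy) // gt_eqF.
Qed.

End LeadingParts.

(** * The Cartan part r^0 *)

Section CartanPart.
Variables (R : realType) (n : nat).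
Local Notation C := R[i].
Local Notation A := (fps R[i]).
Local Notation root := ('I_n * 'I_n)%type.
Local Notation "x # y" := (mxtens_index (x, y)) (at level 30).
Implicit Types (r s : root) (T : bd_triple R n) (z : 'M[C]_(n * n)).

Lemma wedge_diag z : in_h_wedge_h z -> is_diag_mx z.
Proof.
case=> s [/allP ds ->]; apply/is_diag_mxP => x y xy; rewrite summxE big_seq.
apply: big1 => u /ds /andP[/is_diag_mxP d1 /is_diag_mxP d2].
case: (mxtens_indexP x) xy => i k; case: (mxtens_indexP y) => j l.
rewrite /wedge !mxE !mxtens_indexK /= => ne.
have [e|ij] := eqVneq (i : nat) j; last by rewrite (d1 i j) // (d2 i j) // !mul0r subr0.
have [e'|kl] := eqVneq (k : nat) l; last by rewrite (d1 k l) // (d2 k l) // !mulr0 subr0.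
by case/eqP: ne; rewrite (val_inj e) (val_inj e').
Qed.

Lemma wedge_anti z i k j l : in_h_wedge_h z ->
  z (k # i) (l # j) = - z (i # k) (j # l).
Proof.
case=> s [_ ->]; rewrite !summxE -sumrN; apply: eq_bigr => u _.
by rewrite /wedge !mxE !mxtens_indexK /= opprB [X in X - _]mulrC [X in _ - X]mulrC.
Qed.

Lemma contractE (v : 'rV[C]_n) z k l :
  contract v z k l = \sum_i v 0 i * z (i # k) (i # l).
Proof.
rewrite /contract /tlin summxE; apply: eq_bigr => i _; rewrite summxE.
have fE j : Defs.form v (emx i j) = v 0 i * (i == j)%:R.
  rewrite /Defs.form -[RHS](sum_delta (fun t => v 0 t * (t == j)%:R) i).
  by apply: eq_bigr => t _; rewrite emxE -mulnb natrM (eq_sym i t); ring.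
rewrite -(sum_delta (fun j => v 0 i * z (i # k) (j # l)) i).
apply: eq_bigr => j _; rewrite summxE.
rewrite -(sum_delta (fun k => v 0 i * z (i # k) (j # l)) k) mulr_suml.
apply: eq_bigr => k' _; rewrite summxE.
rewrite -(sum_delta (fun l => v 0 i * z (i # k') (j # l)) l) !mulr_suml.
apply: eq_bigr => l' _; rewrite fE [LHS]mxE [X in _ * X = _]mxE emxE -mulnb natrM /tcoef.
ring.
Qed.

Lemma P0mxE (i k j l : 'I_n) :
  P0mx (i # k) (j # l) = (k == i)%:R * (j == i)%:R * (l == i)%:R :> C.
Proof.
rewrite /P0mx summxE -[RHS](sum_delta (fun t => (k == t)%:R * (j == t)%:R * (l == t)%:R)).
apply: eq_bigr => t _; rewrite tensmxE !emxE -!mulnb !natrM; ring.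
Qed.

(** [W *m V] solves the equation; subtracting its transpose makes it skew, and the last term of [Z],
    itself skew by the hypothesis on [V *m U^T], restores the equation. *)
Lemma antisym_solution m (U V : 'M[C]_(m, n)) (W : 'M[C]_(n, m)) :
  U *m W = 1%:M -> V *m U^T = - (U *m V^T) ->
  exists2 Z : 'M[C]_n, U *m Z = V & Z^T = - Z.
Proof.
move=> UW VU; pose Z := W *m V - V^T *m W^T + W *m U *m V^T *m W^T.
exists Z; first by rewrite /Z mulmxDr mulmxBr !mulmxA UW !mul1mx subrK.
rewrite /Z !linearD !linearN /= !trmx_mul !trmxK.
have -> : W *m (V *m (U^T *m W^T)) = - (W *m U *m V^T *m W^T).
  by rewrite (mulmxA V) VU mulNmx mulmxN !mulmxA.
by rewrite opprK [- _ + _]addrC.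
Qed.

(** For the skew coefficient matrix [Z] of [r0] the equations read [U *m Z = V]: the rows of [U] are
    the [alpha - tau alpha], those of [V] are half the [alpha + tau alpha]. *)
Lemma exists_r0 T : exists2 r0, in_h_wedge_h r0 & r0_eq T r0.
Proof.
pose m := #|G1 T|; pose e (a : 'I_m) : root := enum_val a.
pose B : 'M[C]_(m, n) := \matrix_(a, i) vec R (e a) 0 i.
pose B' : 'M[C]_(m, n) := \matrix_(a, i) vec R (tau T (e a)) 0 i.
pose U := B - B'; pose V := 2^-1 *: (B + B').
have eG a : e a \in G1 T := enum_valP a.
have /choice[h hE] : forall b : 'I_m, exists h : 'I_n -> C,
    {in G1 T, forall t, weight h t - weight h (tau T t) = (t == e b)%:R}.
  by move=> b; apply: exists_weight.
(* The columns are weights dual to the [alpha - tau alpha], which exist by nilpotency of [tau]. *)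
pose W : 'M[C]_(n, m) := \matrix_(i, b) h b i.
have UW : U *m W = 1%:M.
  apply/matrixP => a b; rewrite [RHS]mxE -(inj_eq enum_val_inj) -hE // -!lin_vec.
  rewrite [LHS]mxE /lin -sumrB; apply: eq_bigr => i _; rewrite !mxE; ring.
have BB : B *m B^T = B' *m B'^T.
  apply/matrixP => a b; rewrite !mxE; have := dot_tau (eG a) (eG b).
  rewrite /dot => d; transitivity (\sum_i vec R (e a) 0 i * vec R (e b) 0 i).
    by apply: eq_bigr => i _; rewrite !mxE.
  by rewrite -d; apply: eq_bigr => i _; rewrite !mxE.
(* The mixed terms cancel and leave [B *m B^T - B' *m B'^T], which vanishes because [tau] is an
   isometry. *)
have VU : V *m U^T = - (U *m V^T).
  have UT : U^T = B^T - B'^T by rewrite /U linearB.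
  have VT : V^T = 2^-1 *: (B^T + B'^T) by rewrite /V linearZ linearD.
  apply/eqP; rewrite -addr_eq0 UT VT /V -scalemxAl -scalemxAr -scalerDr.
  rewrite !mulmxDl !mulmxDr !mulmxN !mulNmx BB.
  apply/eqP; rewrite -[RHS](scaler0 _ 2^-1); congr (_ *: _).
  move: (B *m B'^T) (B' *m B^T) (B' *m B'^T) => X Y S.
  by apply/matrixP => a b; rewrite !mxE; ring.
have [Z UZ ZT] := antisym_solution UW VU.
(* The factor 1/2 compensates for the wedge, which counts each entry of the skew matrix [Z]
   twice. *)
pose y i : 'M[C]_n := diag_mx (2^-1 *: row i Z).
pose r0 := \sum_(u <- [seq (emx i i, y i) | i <- enum 'I_n]) wedge u.1 u.2.
have r0E i k j l : r0 (i # k) (j # l) = (i == j)%:R * (k == l)%:R * Z i k.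
  rewrite /r0 big_map big_enum summxE.
  transitivity (\sum_t ((i == j)%:R * y t k l) * (i == t)%:R
                - \sum_t ((k == l)%:R * y t i j) * (k == t)%:R).
    rewrite -sumrB; apply: eq_bigr => t _; rewrite /wedge.
    rewrite [LHS]mxE [X in _ + X]mxE !tensmxE !emxE.
    congr (_ - _).
      have [<-|ne] := eqVneq i t; last by rewrite /= !(mul0r, mulr0).
      by rewrite (eq_sym j) /=; ring.
    have [<-|ne] := eqVneq k t; last by rewrite /= !(mul0r, mulr0).
    by rewrite (eq_sym l) /=; ring.
  rewrite !sum_delta /y !mxE.
  have -> : Z k i = - Z i k by have := congr1 (fun X : 'M_n => X i k) ZT; rewrite !mxE.
  by case: (i == j) (k == l) => -[] /=; rewrite ?mulr1n ?mulr0n; field.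
exists r0.
  exists [seq (emx i i, y i) | i <- enum 'I_n]; split=> //.
  apply/allP => u /mapP[i _ ->] /=; rewrite diag_mx_is_diag andbT.
  apply/is_diag_mxP => a b; rewrite emxE => ab.
  by case: (eqVneq a i) (eqVneq b i) ab => [->|//] [->|//]; rewrite eqxx.
move=> t tG; apply/matrixP => k l; rewrite contractE [RHS]mxE contractE.
have [a ->] : exists a, t = e a by exists (enum_rank_in tG t); rewrite /e enum_rankK_in.
have /(congr1 (fun X : 'M_(m, n) => X a k)) := UZ; rewrite [LHS]mxE => UZk.
transitivity ((k == l)%:R * \sum_i U a i * Z i k).
  rewrite mulr_sumr; apply: eq_bigr => i _; by rewrite r0E eqxx mul1r mulrCA !mxE.
rewrite UZk /V !mxE mulrCA; congr (_ * _).
transitivity (\sum_i (vec R (e a) + vec R (tau T (e a))) 0 i * (k == l)%:R * (k == i)%:R).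
  by rewrite sum_delta !mxE mulrC.
apply: eq_bigr => i _; rewrite P0mxE eqxx mulr1.
by have [<-|_] := eqVneq k i; rewrite !(mulr0, mul0r, mulr1, mul1r) // (eq_sym l).
Qed.

(** * Two-sided multiplication by the diagonal matrix [qexp z], and change of solution *)

Lemma R_twistE (X : 'M[A]_(n * n)) z x y : is_diag_mx z ->
  (qexp z *m X *m qexp z) x y = qpow (z x x) * X x y * qpow (z y y).
Proof.
move=> dz; rewrite qexp_diag // mul_mx_diag [LHS]mxE mul_diag_mx.
by rewrite [X in X * _]mxE ![(\row_i _) _ _]mxE.
Qed.

Lemma twist_cancel z (X Y : 'M[A]_(n * n)) : is_diag_mx z ->
  qexp z *m X *m qexp z = qexp z *m Y *m qexp z -> X = Y.
Proof.
move=> dz e; apply/matrixP => x y.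
have {}e : qpow (z x x) * X x y * qpow (z y y) = qpow (z x x) * Y x y * qpow (z y y).
  by rewrite -(R_twistE X x y dz) e (R_twistE Y x y dz).
have E (a : A) : a = qpow (- z x x) * (qpow (z x x) * a * qpow (z y y)) * qpow (- z y y).
  rewrite -!mulrA qpowNK mulr1 mulrA [_ * qpow (z x x)]mulrC qpowNK mul1r.
  by [].
by rewrite (E (X x y)) e -E.
Qed.

Lemma lead_qexp (h : 'I_(n * n) -> C) z : is_diag_mx z -> lead h (qexp z) (qexp z).
Proof.
by move=> dz; rewrite qexp_diag //; apply: lead_diag; apply: diag_mx_is_diag.
Qed.

Lemma bd_sub_refl T : bd_sub T T.
Proof. by split. Qed.

(* R_GGS r0' is the twist of R_GGS r0 by q^z, z = r0' - r0. Each column of z, read as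
   a weight, is tau-invariant, so the twist is compatible with the weights of R_GGS. *)
Lemma change_r0 T (r0 r0' : 'M[C]_(n * n)) : in_h_wedge_h r0 -> in_h_wedge_h r0' ->
  r0_eq T r0 -> r0_eq T r0' ->
  (QYBE (R_GGS T r0) -> QYBE (R_GGS T r0'))
  /\ (forall q qV, Hecke q qV (R_GGS T r0) -> Hecke q qV (R_GGS T r0')).
Proof.
move=> w0 w0' eq0 eq0'; have [d0 d0'] := (wedge_diag w0, wedge_diag w0').
pose z := r0' - r0; have zE x y : z x y = r0' x y - r0 x y by rewrite !mxE.
pose f i k : A := qpow (z (i # k) (i # k)).
have fN i k : f i k * f k i = 1.
  have -> : f k i = qpow (- z (i # k) (i # k)); last exact: qpowNK.
  rewrite /f !zE (wedge_anti i k i k w0).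
  by rewrite (wedge_anti i k i k w0') opprB opprK addrC.
have YE i k j l : R_GGS T r0' (i # k) (j # l)
    = f i k * R_GGS T r0 (i # k) (j # l) * f j l.
  rewrite [LHS](R_twistE _ _ _ d0') [R_GGS T r0 _ _](R_twistE _ _ _ d0).
  have E x : qpow (r0' x x) = qpow (z x x) * qpow (r0 x x).
    by rewrite -qpowD zE subrK.
  rewrite !E /f; move: (Rbar_GGS T _ _) => b; ring.
split; last by move=> q qV; apply: (Hecke_twist fN YE).
apply: (QYBE_twist fN YE) => i k j l p; rewrite [R_GGS T r0 _ _](R_twistE _ _ _ d0) => nz.
pose h a := z (a # p) (a # p).
(* With [T] taken as its own subtriple the right side is 0 on [G1 T], so [Rbar_GGS T] turns out to
   be its own weight-0 part for [h]. *)
have hh : {in G1 T, forall t,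
    weight h t - weight h (tau T t) = (t \notin G1 T)%:R}.
  move=> t tG; rewrite tG -!lin_vec /lin -sumrB.
  have := eq0' t tG; rewrite -(eq0 t tG).
  move=> /(congr1 (fun X : 'M_n => X p p)); rewrite !contractE => /eqP.
  rewrite -subr_eq0 -sumrB => /eqP e; apply: (etrans _ e); apply: eq_bigr => i' _.
  by rewrite /h zE; move: (vec R t) (vec R (tau T t)) => u v; rewrite !mxE; ring.
have /lead_idP/(_ (i # k) (j # l)) := lead_Rbar_GGS (bd_sub_refl T) hh.
rewrite !wtensE /f -!qpowD => -> //.
by apply: contraNneq nz => ->; rewrite mulr0 mul0r.
Qed.

End CartanPart.

Theorem theorem1p6 (R : realType) (n : nat) (hn : (2 <= n)%N)
    (T' T : bd_triple R n) (hsub : bd_sub T' T) :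
  (GGS_conjecture T -> GGS_conjecture T') /\
  (twist_conjecture T -> twist_conjecture T').
Proof.
have [h hh] := exists_weight T (fun t => (t \notin G1 T')%:R : R[i]).
have [r0 w0 e0] := exists_r0 T; have d0 := wedge_diag w0.
(* The equations for [T'] are among those for [T], so one [r0] serves both triples. *)
have e0' : r0_eq T' r0.
  by move=> t tG; rewrite (tau_sub hsub tG); apply/e0/(G1_sub hsub).
have lR := lead_Rbar_GGS hsub hh.
have lR0 : lead (wtens h h) (R_GGS T r0) (R_GGS T' r0).
  by apply: leadM (lead_qexp _ d0); apply: leadM lR; apply: lead_qexp.
split=> [ggs|twist] r0' w0' e0''; have [qy hk] := change_r0 w0 w0' e0' e0''.
  have [qT hT] := ggs _ w0 e0.
  by split; [apply/qy/(lead_QYBE lR0) | apply/hk/(lead_Hecke lR0)].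
have [qT RT] := twist _ w0 e0.
(* Without its diagonal factors the identity no longer involves the solution, so it can be
   reinstated with [r0'] after passing to [T']. *)
have eT := twist_cancel d0 RT.
have lJ := lead_Jmx hsub hh.
have eT' : Rbar_J T' = Rbar_GGS T'.
  (* Clearing the inverse of [Jmx T] gives an identity between products of triangular matrices, to
     which [lead_inj] applies; the inverse is restored afterwards for [T']. *)
  have e : Jmx T *m Rbar_GGS T = Rs R n *m swap (Jmx T).
    rewrite -eT /Rbar_J -mulmxA.
    exact: (mulKVmx (Jmx_unit T)).
  have e' : Jmx T' *m Rbar_GGS T' = Rs R n *m swap (Jmx T').
    apply: (lead_inj (leadM lJ lR)); rewrite e.
    by apply: leadM; [apply: lead_Rs | apply: lead_swap].
  rewrite /Rbar_J -mulmxA -e'.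
  exact: (mulKmx (Jmx_unit T')).
have RT' : R_J T' r0' = R_GGS T' r0'.
  exact: (congr1 (fun X => qexp r0' *m X *m qexp r0') eT').
split; last exact: RT'.
(* The QYBE is routed through [R_GGS], for which the weight-0 part and the change of solution are
   available. *)
rewrite RT'; apply/qy/(lead_QYBE lR0); rewrite -RT; exact: qT.
Qed.
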